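(* Let $Z$ be a standard normal random variable, let $m\ge1$, and let $G:\mathbb{R}\to\mathbb{R}$ be $(m+1)$-times continuously differentiable with $\mathbb{E}\left(G^{(k)}(Z)^2\right)<+\infty$ for $k=0,\dots,m+1$. Then for all $k\in\{1,\dots,m\}$, $$\frac{\left(\mathbb{E}\,G^{(k+1)}(Z)\right)^2}{(k+1)!}\le(-1)^k\left(\mathrm{Var}\,G(Z)-\mathbb{E}\left(G'(Z)^2\right)+\dots+(-1)^k\frac{\mathbb{E}\left(G^{(k)}(Z)^2\right)}{k!}\right)\le\frac{\mathbb{E}\left(G^{(k+1)}(Z)^2\right)}{(k+1)!},$$ and $$\frac{\left(\mathbb{E}\,G^{(k+1)}(Z)\right)^2}{(k+1)!}\le\mathrm{Var}\,G(Z)-\left(\mathbb{E}\,G'(Z)\right)^2-\frac{\left(\mathbb{E}\,G''(Z)\right)^2}{2}-\dots-\frac{\left(\mathbb{E}\,G^{(k)}(Z)\right)^2}{k!}\le\frac{\mathbb{E}\left(G^{(k+1)}(Z)^2\right)}{(k+1)!}.$$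
   Context: $G^{(k)}$ denotes the $k$-th derivative of $G$, with $G^{(0)}=G$. The sum in the first display is $\mathrm{Var}\,G(Z)+\sum_{j=1}^k(-1)^j\mathbb{E}(G^{(j)}(Z)^2)/j!$. *)

(* Defs.v *)
From HB Require Import structures.
From mathcomp Require Export all_boot all_order all_algebra.
From mathcomp Require Export all_classical all_reals all_analysis.
Export numFieldNormedType.Exports.

Set Implicit Arguments.
Unset Strict Implicit.
Unset Printing Implicit Defensive.

Local Open Scope ring_scope.
Local Open Scope classical_set_scope.

(* [G^`(k)] is a total function, so the existence of each derivative is asked
   for explicitly; continuity of the derivatives of order < n follows. *)
Definition continuously_differentiable (R : realType) (n : nat) (G : R -> R)
    : Prop :=
  (forall (k : nat) (x : R), (k < n)%N -> derivable G^`(k) x 1) /\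
  continuous G^`(n).

(* The laws are compared on measurable sets only: off the sigma-algebra the
   values of both set functions are meaningless. *)
Definition standard_normal (d : measure_display) (T : measurableType d)
    (R : realType) (P : probability T R) (Z : {RV P >-> R}) : Prop :=
  forall A : set R, measurable A -> distribution P Z A = normal_prob 0 1 A.

(* Main.v *)
(** Write [gamma] for the standard normal law and [c_n f] for the [n]-th Hermite
    coefficient of [f] in [L^2(gamma)]. Integration by parts gives
    [c_n (f') = c_(n+1) f], so with [a_n = (c_n G)^2 / n!] one expects
    [E (G^(j)(Z)^2) / j! = \sum_n 'C(n, j) a_n], and [Var G(Z) = \sum_(n >= 1) a_n].
    The two middle terms of the theorem are then [\sum_(n >= 1) 'C(n - 1, k) a_n]
    and [\sum_(n > k) a_n]; both lie between [a_(k+1)] and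
    [\sum_n 'C(n, k + 1) a_n <= E (G^(k+1)(Z)^2) / (k+1)!] (Bessel).

    Completeness of the Hermite polynomials is replaced by the spectral gap: if
    [f] is orthogonal to the [N] first Hermite polynomials then
    [N E f^2 <= E f'^2], whence Parseval's identity, with rate [1/N], for the
    derivatives of order at most [m]. *)

Require Import Defs.
From mathcomp Require Import measurable_realfun ring lra.
Import Order.TTheory GRing.Theory Num.Theory.

Set Implicit Arguments.
Unset Strict Implicit.
Unset Printing Implicit Defensive.

Local Open Scope ring_scope.
Local Open Scope classical_set_scope.

(** * The Gaussian weight *)

Section GaussianWeight.
Context {R : realType}.
Implicit Types (x : R) (f g : R -> R).
Local Notation mu := (@lebesgue_measure R).
Local Notation w := (normal_pdf (0 : R) 1).

Lemma stdn_pdfE x : w x = normal_peak 1 * expR (- x ^+ 2 / 2).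
Proof. by rewrite normal_pdfE ?oner_neq0// /normal_fun subr0 expr1n. Qed.

Lemma stdn_pdf_gt0 x : 0 < w x.
Proof. by rewrite stdn_pdfE mulr_gt0 ?expR_gt0 ?normal_peak_gt0 ?oner_neq0. Qed.

Lemma continuous_stdn_pdf : continuous w.
Proof. by apply: continuous_normal_pdf; exact: oner_neq0. Qed.

Lemma is_derive_stdn_pdf x : is_derive x 1 w (- x * w x).
Proof.
have -> : w = (fun x => normal_peak 1 * expR (- x ^+ 2 / 2)).
  by apply/funext => y; exact: stdn_pdfE.
by apply: is_derive_eq; rewrite /GRing.scale /=; field.
Qed.

Lemma stdn_pdfN x : w (- x) = w x.
Proof. by rewrite !stdn_pdfE sqrrN. Qed.

Lemma stdn_pdf_cvg0 : w x @[x --> +oo] --> 0.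
Proof.
apply: (@squeeze_cvgr _ _ _ _ (cst 0) (fun x => normal_peak 1 * expR (- x))).
(* From [x = 2] on, [x <= x ^+ 2 / 2]. *)
- near=> x; rewrite ltW ?stdn_pdf_gt0//= stdn_pdfE ler_wpM2l ?normal_peak_ge0//.
  rewrite ler_expR; have : 2 <= x by near: x; exact: nbhs_pinfty_ge.
  by move=> ?; nra.
- exact: cvg_cst.
- by rewrite -[X in _ --> X](mulr0 (normal_peak 1)); apply: cvgMr; exact: cvgr_expR.
Unshelve. all: by end_near. Qed.

Lemma is_derive_continuous (f f' : R -> R) :
  (forall x, is_derive x 1 f (f' x)) -> continuous f.
Proof.
move=> df x; apply: differentiable_continuous.
by apply/derivable1_diffP; apply: ex_derive.
Qed.

Lemma Rintegral_derive (K k : R -> R) (a b : R) : a < b ->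
  (forall x, is_derive x 1 K (k x)) -> continuous k ->
  \int[mu]_(x in `[a, b]) k x = K b - K a.
Proof.
move=> ab dK ck.
rewrite /Rintegral (@continuous_FTC2 _ k K)//.
- exact: continuous_subspaceT.
- have cK := is_derive_continuous dK.
  split => [x _||].
  + exact: ex_derive.
  + exact/cvg_at_right_filter/cK.
  + exact/cvg_at_left_filter/cK.
- by move=> x _; rewrite derive1E derive_val.
Qed.

(* Testing against the cutoff [1 - x^2/n^2] on [[-n, n]], which vanishes at the
   endpoints, spares the study of the limits of [K] at infinity. *)
Lemma Rintegral_derive_eq0 (K k : R -> R) :
  (forall x, is_derive x 1 K (k x)) -> continuous k ->
  mu.-integrable setT (EFin \o K) -> mu.-integrable setT (EFin \o k) ->
  \int[mu]_x k x = 0.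
Proof.
move=> dK ck iK ik.
have cK := is_derive_continuous dK.
pose c n x : R := 1 - (x / n.+1%:R) ^+ 2.
pose c' n x : R := - (2 * x / n.+1%:R ^+ 2).
pose g n x := k x * c n x + K x * c' n x.
pose I n := `[- n.+1%:R, n.+1%:R : R].
have n0 n : n.+1%:R != 0 :> R by rewrite pnatr_eq0.
have dc n x : is_derive x 1 (c n) (c' n x).
  by rewrite /c; apply: is_derive_eq; rewrite /GRing.scale /= /c'; field.
have dc' n x : is_derive x 1 (c' n) (- (2 / n.+1%:R ^+ 2)).
  by rewrite /c'; apply: is_derive_eq; rewrite /GRing.scale /=; field.
have dg n x : is_derive x 1 (fun x => K x * c n x) (g n x).
  have ? := dK x; have ? := dc n x.
  by apply: is_derive_eq; rewrite /GRing.scale /= /g; ring.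
have cg n : continuous (g n).
  move=> x; apply: cvgD; apply: cvgM; [exact: ck| |exact: cK|].
    exact: is_derive_continuous (dc n) x.
  exact: is_derive_continuous (dc' n) x.
have Ig n : \int[mu]_(x in I n) g n x = 0.
  rewrite (@Rintegral_derive (fun x => K x * c n x))//; last by rewrite gtrN.
  by rewrite /c mulNr !divff// sqrrN expr1n subrr !mulr0 subrr.
have x01 n x : I n x -> 0 <= (x / n.+1%:R) ^+ 2 <= 1.
  rewrite /I/= in_itv/= -ler_norml => xn.
  rewrite sqr_ge0 -[leRHS](expr1n _ 2) -real_normK ?num_real//.
  by rewrite lerXn2r ?nnegrE// normrM normfV (ger0_norm (ler0n _ _)) ler_pdivrMr ?mul1r.
(* On [I n], [c n] is bounded by 1 and [c' n] by [2 / n.+1 <= 2], whence the majorant [|k| + 2 |K|].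
   The integrals of [g n] over [I n] all vanish, and the integrands tend to [k]. *)
have [] := @dominated_convergence _ _ _ mu setT measurableT
  (fun n => EFin \o (g n \_ (I n))) (EFin \o k)
  (fun x => (`|k x| + 2 * `|K x|)%:E).
- move=> n; apply/measurable_EFinP/(measurable_restrictT _ _).1.
    exact: measurable_itv.
  by apply: measurable_funTS; exact: continuous_measurable_fun.
- by apply/measurable_EFinP; exact: continuous_measurable_fun.
- apply: aeW => x _ /=; apply: cvg_EFin; first exact: nearW.
  have h0 : (fun n => (x * harmonic n : R)) @ \oo --> (0 : R).
    by rewrite -[X in _ --> X](mulr0 x); apply: cvgMr; exact: cvg_harmonic.
  have hc : (fun n => c n x) @ \oo --> (1 : R).
    rewrite -[X in _ --> X]subr0 -[X in 1 - X](mulr0 0).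
    by apply: cvgB; [exact: cvg_cst|under eq_fun do rewrite expr2; exact: cvgM].
  have hc' : (fun n => c' n x) @ \oo --> (0 : R).
    rewrite -[X in _ --> X]oppr0 -[X in - X](mulr0 (2 * 0)).
    apply: cvgN; under eq_fun do rewrite expr2 invfM mulrA -(mulrA 2).
    by apply: cvgM; [apply: cvgMr; exact: h0|exact: cvg_harmonic].
  have hg : (fun n => g n x) @ \oo --> k x.
    rewrite -[X in _ --> X]addr0 -[X in _ + X](mulr0 (K x)) -[X in X + _]mulr1.
    by apply: cvgD; apply: cvgMr.
  apply: cvg_trans hg; apply: near_eq_cvg; near=> n.
  rewrite /= patchE mem_set// /I/= in_itv/= -ler_norml.
  apply: (@le_trans _ _ n%:R); last by rewrite ler_nat.
  by near: n; exact: nbhs_infty_ger.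
- have := integrableD measurableT (integrable_norm ik)
    (integrableZl measurableT 2 (integrable_norm iK)).
  by apply: eq_integrable => //.
- apply: aeW => x n _ /=; rewrite patchE lee_fin.
  case: ifPn => [|_]; last by rewrite normr0 addr_ge0 ?mulr_ge0.
  rewrite inE => /x01 /andP[u0 u1].
  rewrite (le_trans (ler_normD _ _))// lerD// normrM.
    rewrite ler_piMr// ler_norml /c; move: (_ ^+ 2) u0 u1 => u u0 u1.
    by apply/andP; split; lra.
  rewrite mulrC ler_wpM2r// /c' normrN.
  (* Squaring brings in [(x / n.+1) ^+ 2], already known to be at most 1. *)
  rewrite -(@ler_pXn2r _ 2)// ?nnegrE// real_normK ?num_real//.
  rewrite [X in X <= _](_ : _ = 4 * (x / n.+1%:R) ^+ 2 / n.+1%:R ^+ 2); last by field.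
  have N1 : 1 <= n.+1%:R ^+ 2 :> R by rewrite -natrX ler1n expn_gt0.
  rewrite ler_pdivrMr ?(lt_le_trans ltr01)//.
  by move: ((x / _) ^+ 2) (n.+1%:R ^+ 2) u1 N1 => u N u1 N1; lra.
have ig n : mu.-integrable (I n) (EFin \o g n).
  by apply: continuous_compact_integrable;
    [exact: segment_compact|exact: continuous_subspaceT].
move=> _ _.
under eq_fun do rewrite -restrict_EFin -integral_mkcond.
under eq_fun => n.
  rewrite -(fineK (integrable_fin_num _ (ig n))); last exact: measurable_itv.
  rewrite [fine _](Ig n); over.
move=> /cvg_lim; rewrite lim_cst// /Rintegral => <-//.
Unshelve. all: by end_near.
Qed.
End GaussianWeight.

(** * Expectation, integrability and square integrability under the Gaussian weight *)

Section GaussianExpectation.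
Context {R : realType}.
Implicit Types (x : R) (f g : R -> R).
Local Notation mu := (@lebesgue_measure R).
Local Notation w := (normal_pdf (0 : R) 1).

Definition gaussE f : R := \int[mu]_x (f x * w x).

Definition gaussL1 f := mu.-integrable setT (EFin \o (fun x => f x * w x)).

(** Measurability is asked for separately: that of the square does not imply that of [f]. *)
Definition gaussL2 f :=
  measurable_fun setT f /\ gaussL1 (fun x => f x ^+ 2).

Lemma gaussL1D f g : gaussL1 f -> gaussL1 g -> gaussL1 (fun x => f x + g x).
Proof.
move=> if_ ig; have := integrableD measurableT if_ ig.
by apply: eq_integrable => // x _ /=; rewrite mulrDl.
Qed.

Lemma gaussL1Z (a : R) f : gaussL1 f -> gaussL1 (fun x => a * f x).
Proof.
move=> if_; have := integrableZl measurableT a if_.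
by apply: eq_integrable => // x _ /=; rewrite -EFinM mulrA.
Qed.

Lemma gaussL1B f g : gaussL1 f -> gaussL1 g -> gaussL1 (fun x => f x - g x).
Proof.
move=> if_ ig; have := integrableB measurableT if_ ig.
by apply: eq_integrable => // x _ /=; rewrite mulrBl.
Qed.

Lemma gaussED f g : gaussL1 f -> gaussL1 g ->
  gaussE (fun x => f x + g x) = gaussE f + gaussE g.
Proof.
move=> if_ ig; rewrite /gaussE -RintegralD//.
by apply: eq_Rintegral => x _; rewrite mulrDl.
Qed.

Lemma gaussEB f g : gaussL1 f -> gaussL1 g ->
  gaussE (fun x => f x - g x) = gaussE f - gaussE g.
Proof.
move=> if_ ig; rewrite /gaussE -RintegralB//.
by apply: eq_Rintegral => x _; rewrite mulrBl.
Qed.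

Lemma gaussEZ (a : R) f : gaussL1 f -> gaussE (fun x => a * f x) = a * gaussE f.
Proof.
move=> if_; rewrite /gaussE -RintegralZl//.
by apply: eq_Rintegral => x _; rewrite mulrA.
Qed.

Lemma gaussE_ge0 f : (forall x, 0 <= f x) -> 0 <= gaussE f.
Proof.
by move=> f0; apply: Rintegral_ge0 => x _; rewrite mulr_ge0// ltW ?stdn_pdf_gt0.
Qed.

Lemma le_gaussL1 f g : measurable_fun setT f -> (forall x, `|f x| <= g x) ->
  gaussL1 g -> gaussL1 f.
Proof.
move=> mf fg; apply: le_integrable => //.
  by apply/measurable_EFinP; apply: measurable_funM => //; exact: measurable_normal_pdf.
move=> x _ /=; rewrite lee_fin !normrM ler_wpM2r//.
exact/(le_trans (fg x))/ler_norm.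
Qed.

Lemma gaussL2M f g : gaussL2 f -> gaussL2 g -> gaussL1 (fun x => f x * g x).
Proof.
move=> [mf if_] [mg ig].
apply: (le_gaussL1 _ _ (gaussL1D if_ ig)); first exact: measurable_funM.
move=> x; rewrite normrM -(real_normK (num_real (f x))) -(real_normK (num_real (g x))).
by have := sqr_ge0 (`|f x| - `|g x|); have := normr_ge0 (f x); have := normr_ge0 (g x); nra.
Qed.

Lemma gaussL2Z (a : R) f : gaussL2 f -> gaussL2 (fun x => a * f x).
Proof.
move=> [mf if_]; split; first exact: measurable_funM.
by under eq_fun do rewrite exprMn; exact: gaussL1Z.
Qed.

Lemma gaussL2D f g : gaussL2 f -> gaussL2 g -> gaussL2 (fun x => f x + g x).
Proof.
move=> hf hg; split; first by apply: measurable_funD; [case: hf|case: hg].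
have -> : (fun x => (f x + g x) ^+ 2) =
          (fun x => (f x ^+ 2 + g x ^+ 2) + 2 * (f x * g x)).
  by apply/funext => x; ring.
by apply: gaussL1D; [apply: gaussL1D; [case: hf|case: hg]|exact/gaussL1Z/gaussL2M].
Qed.

Lemma gaussL2B f g : gaussL2 f -> gaussL2 g -> gaussL2 (fun x => f x - g x).
Proof.
move=> hf hg; have -> : (fun x => f x - g x) = (fun x => f x + (-1) * g x).
  by apply/funext => x; ring.
by apply: gaussL2D => //; exact: gaussL2Z.
Qed.

(** Serves for the discriminant in Cauchy-Schwarz, with [t = 1] for the residual of a projection,
    and with [t = n + 1] in the spectral gap. *)
Lemma gaussE_sqrB (t : R) f g : gaussL2 f -> gaussL2 g ->
  gaussE (fun x => (f x - t * g x) ^+ 2) =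
  gaussE (fun x => f x ^+ 2) - 2 * t * gaussE (fun x => f x * g x) +
  t ^+ 2 * gaussE (fun x => g x ^+ 2).
Proof.
move=> hf hg; have hfg := gaussL2M hf hg; have [_ hf2] := hf; have [_ hg2] := hg.
have -> : (fun x => (f x - t * g x) ^+ 2) =
  (fun x => (f x ^+ 2 - (2 * t) * (f x * g x)) + t ^+ 2 * g x ^+ 2).
  by apply/funext => x; ring.
rewrite gaussED ?gaussEB ?gaussEZ//; last exact: gaussL1Z.
  exact: gaussL1Z.
by apply: gaussL1B => //; exact: gaussL1Z.
Qed.

Lemma gaussE_cauchy_schwarz f g : gaussL2 f -> gaussL2 g ->
  gaussE (fun x => f x * g x) ^+ 2 <=
  gaussE (fun x => f x ^+ 2) * gaussE (fun x => g x ^+ 2).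
Proof.
move=> hf hg.
have q t : 0 <= gaussE (fun x => f x ^+ 2) - 2 * t * gaussE (fun x => f x * g x) +
  t ^+ 2 * gaussE (fun x => g x ^+ 2).
  by rewrite -gaussE_sqrB//; apply: gaussE_ge0 => x; exact: sqr_ge0.
have : 0 <= gaussE (fun x => g x ^+ 2) by apply: gaussE_ge0 => x; exact: sqr_ge0.
move: (gaussE (fun x => f x ^+ 2)) (gaussE (fun x => f x * g x))
  (gaussE (fun x => g x ^+ 2)) q => a p b q.
(* If [b = 0] the polynomial is affine in [t], and for [p != 0] the chosen [t] gives it the value
   -1. Otherwise its minimum is at [t = p / b]. *)
rewrite le_eqVlt => /predU1P[b0|b0].
  rewrite -b0 mulr0; case: (eqVneq p 0) => [->|p0]; first by rewrite expr0n.
  have := q ((a + 1) / (2 * p)); rewrite -b0 mulr0 addr0.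
  by rewrite [X in 0 <= X](_ : _ = -1) ?oppr_ge0 ?ler10//; field.
have := q (p / b).
rewrite [X in 0 <= X](_ : _ = (a * b - p ^+ 2) / b); last by field; rewrite gt_eqF.
by rewrite pmulr_lge0 ?invr_gt0// subr_ge0.
Qed.

(** Half of the exponent absorbs the power: [y ^+ n <= n! e^y] at [y = x^2 / 4] leaves
    [e^(- x^2 / 4)], the density of variance 2 up to a constant. *)
Lemma gaussL1_exp_even n : gaussL1 (fun x => x ^+ n.*2).
Proof.
have s2 : Num.sqrt 2 != 0 :> R by rewrite gt_eqF// sqrtr_gt0.
pose C := 4 ^+ n * n`!%:R * normal_peak 1 / normal_peak (Num.sqrt 2 : R).
have := integrableZl measurableT C (integrable_normal_pdf 0 (Num.sqrt 2 : R)).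
apply: le_integrable => //.
  apply/measurable_EFinP; apply: measurable_funM; first exact: measurable_funX.
  exact: measurable_normal_pdf.
move=> x _ /=; rewrite lee_fin.
have xn0 : 0 <= x ^+ n.*2 by rewrite -mul2n exprM exprn_ge0 ?sqr_ge0.
rewrite ger0_norm; last by rewrite mulr_ge0 ?normal_pdf_ge0.
rewrite (le_trans _ (ler_norm _))//.
rewrite stdn_pdfE normal_pdfE// /normal_fun subr0 sqr_sqrtr//.
rewrite /C; move: (normal_peak_gt0 s2) (@normal_peak_ge0 R 1).
move: (normal_peak 1) (normal_peak _) => p q q0 p0.
have -> : - x ^+ 2 / 2 = - (x ^+ 2 / 4) + - x ^+ 2 / (2 *+ 2) by field.
rewrite expRD expRN; have := expR_gt0 (- x ^+ 2 / (2 *+ 2)).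
move: (expR (- x ^+ 2 / _)) => F F0.
have h : x ^+ n.*2 <= 4 ^+ n * n`!%:R * expR (x ^+ 2 / 4).
  have x4 : 0 <= x ^+ 2 / 4 by rewrite divr_ge0 ?sqr_ge0.
  have -> : x ^+ n.*2 = 4 ^+ n * (x ^+ 2 / 4) ^+ n.
    by rewrite -exprMn mulrCA divff ?mulr1// -exprM mul2n.
  rewrite -mulrA ler_wpM2l ?exprn_ge0//.
  case: n {xn0 C} => [|n]; first by rewrite expr0 fact0 mul1r -[leLHS]expR0 ler_expR.
  rewrite [leRHS]mulrC -ler_pdivrMr ?ltr0n ?fact_gt0//.
  by apply: le_trans (expR_ge1Dxn n x4); rewrite lerDr.
rewrite [leRHS](_ : _ = 4 ^+ n * n`!%:R * expR (x ^+ 2 / 4) * (p / expR (x ^+ 2 / 4) * F)).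
  by rewrite (mulrA p) ler_wpM2r// !mulr_ge0 ?invr_ge0 ?expR_ge0// ltW.
by field; rewrite !gt_eqF// expR_gt0.
Qed.
End GaussianExpectation.

(** * Integration by parts and Hermite polynomials *)

Section Hermite.
Context {R : realType}.
Implicit Types (x : R) (f g : R -> R) (p : {poly R}).
Local Notation mu := (@lebesgue_measure R).
Local Notation w := (normal_pdf (0 : R) 1).

(** As [w' = - x w], the difference of the integrands is [(f g w)'], and [f g w] is integrable. Thus
    [g |-> x g - g'] is the adjoint of differentiation. *)
Lemma gaussE_by_parts f f' g g' :
  (forall x, is_derive x 1 f (f' x)) -> continuous f' ->
  (forall x, is_derive x 1 g (g' x)) -> continuous g' ->
  gaussL2 f -> gaussL2 f' -> gaussL2 g -> gaussL2 (fun x => x * g x - g' x) ->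
  gaussE (fun x => f' x * g x) = gaussE (fun x => f x * (x * g x - g' x)).
Proof.
move=> df cf' dg cg' f2 f'2 g2 dg2.
have cf := is_derive_continuous df; have cg := is_derive_continuous dg.
apply/eqP; rewrite -subr_eq0 -gaussEB; try exact: gaussL2M.
apply/eqP; apply: (@Rintegral_derive_eq0 _ (fun x => f x * g x * w x)).
- move=> x; have ? := df x; have ? := dg x; have ? := is_derive_stdn_pdf x.
  by apply: is_derive_eq; rewrite /GRing.scale /=; ring.
- move=> x; apply: cvgM; last exact: continuous_stdn_pdf.
  apply: cvgB; apply: cvgM; [exact: cf'|exact: cg|exact: cf|].
  by apply: cvgB; [apply: cvgM; [exact: cvg_id|exact: cg]|exact: cg'].
- exact: gaussL2M.
- by apply: gaussL1B; exact: gaussL2M.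
Qed.

Lemma gaussL2_exp n : gaussL2 (fun x => x ^+ n).
Proof.
split; first exact: measurable_funX.
under eq_fun do rewrite -exprM muln2; exact: gaussL1_exp_even.
Qed.

Lemma gaussL2_sum n (F : nat -> R -> R) : (forall i, gaussL2 (F i)) ->
  gaussL2 (fun x => \sum_(i < n) F i x).
Proof.
move=> hF; elim: n => [|n IHn].
  under eq_fun do rewrite big_ord0.
  have := gaussL2Z 0 (hF 0%N); by under eq_fun do rewrite mul0r.
under eq_fun do rewrite big_ord_recr/=; exact: gaussL2D.
Qed.

Lemma gaussL2_horner p : gaussL2 (fun x => p.[x]).
Proof.
under eq_fun do rewrite horner_coef.
apply: (@gaussL2_sum _ (fun i x => p`_i * x ^+ i)) => i.
exact/gaussL2Z/gaussL2_exp.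
Qed.

(** The probabilists' Hermite polynomials, generated by the adjoint of differentiation. *)
Fixpoint hermite n : {poly R} :=
  if n is n'.+1 then 'X * hermite n' - deriv (hermite n') else 1.

Lemma deriv_hermiteS n : deriv (hermite n.+1) = hermite n *+ n.+1.
Proof.
elim: n => [|n IHn].
  by rewrite /= mulr1 derivB derivX !derivC subr0.
have -> : hermite n.+2 = 'X * hermite n.+1 - hermite n *+ n.+1 by rewrite -IHn.
rewrite derivB derivM derivX mul1r IHn derivMn mulrnAr -addrA -mulrnBl.
by rewrite -mulrS.
Qed.

Lemma gaussL2_cst (c : R) : gaussL2 (fun=> c).
Proof. by have := gaussL2_horner c%:P; under eq_fun do rewrite hornerC. Qed.

Lemma gaussE_cst (c : R) : gaussE (fun=> c) = c.
Proof.
rewrite /gaussE RintegralZl//; last exact: integrable_normal_pdf.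
by rewrite /Rintegral integral_normal_pdf mulr1.
Qed.

(** Not normalized: [hermite n] has squared norm [n!], hence the divisions by [n!] in the
    projections and in Bessel's inequality. *)
Definition hermite_coef n f : R := gaussE (fun x => f x * (hermite n).[x]).

Lemma hermite_coef0 f : hermite_coef 0 f = gaussE f.
Proof. by rewrite /hermite_coef; under eq_fun do rewrite hornerC mulr1. Qed.

Lemma hermite_coefS f f' n :
  (forall x, is_derive x 1 f (f' x)) -> continuous f' ->
  gaussL2 f -> gaussL2 f' -> hermite_coef n.+1 f = hermite_coef n f'.
Proof.
move=> df cf' f2 f'2; apply/esym.
have H1 x : (hermite n.+1).[x] = x * (hermite n).[x] - (deriv (hermite n)).[x].
  by rewrite /= !hornerE.
rewrite /hermite_coef; under [in RHS]eq_fun do rewrite H1.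
apply: gaussE_by_parts => //; try exact: gaussL2_horner.
- exact: continuous_horner.
- by under eq_fun do rewrite -H1; exact: gaussL2_horner.
Qed.

Lemma hermite_coefD n f g : gaussL2 f -> gaussL2 g ->
  hermite_coef n (fun x => f x + g x) = hermite_coef n f + hermite_coef n g.
Proof.
move=> hf hg; rewrite /hermite_coef -gaussED; try exact/gaussL2M/gaussL2_horner.
by congr gaussE; apply/funext => x; rewrite mulrDl.
Qed.

Lemma hermite_coefZ n (a : R) f : gaussL2 f ->
  hermite_coef n (fun x => a * f x) = a * hermite_coef n f.
Proof.
move=> hf; rewrite /hermite_coef -gaussEZ; last exact/gaussL2M/gaussL2_horner.
by congr gaussE; apply/funext => x; rewrite mulrA.
Qed.

Lemma hermite_coef_cst0 n : hermite_coef n (fun=> 0) = 0.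
Proof.
by rewrite /hermite_coef; under eq_fun do rewrite mul0r; exact: gaussE_cst.
Qed.

Lemma hermite_coef_sum n N (F : nat -> R -> R) : (forall i, gaussL2 (F i)) ->
  hermite_coef n (fun x => \sum_(i < N) F i x) = \sum_(i < N) hermite_coef n (F i).
Proof.
move=> hF; elim: N => [|N IHN].
  by rewrite big_ord0; under eq_fun do rewrite big_ord0; exact: hermite_coef_cst0.
under eq_fun do rewrite big_ord_recr/=.
by rewrite hermite_coefD ?big_ord_recr/= ?IHN//; exact: gaussL2_sum.
Qed.

Lemma hermite_coefS_cst n (c : R) : hermite_coef n.+1 (fun=> c) = 0.
Proof.
rewrite (@hermite_coefS _ (fun=> 0)) ?hermite_coef_cst0//; try exact: gaussL2_cst.
by move=> x; exact: cvg_cst.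
Qed.

(** Integration by parts lowers [n] while differentiating [hermite m], which lowers [m] and yields a
    factor [m]. *)
Lemma hermite_coef_hermite n m :
  hermite_coef n (fun x => (hermite m).[x]) = (n`!)%:R *+ (n == m).
Proof.
elim: n m => [|n IHn] [|m].
- by rewrite hermite_coef0 -[RHS](gaussE_cst 1); under eq_fun do rewrite hornerC.
- rewrite hermite_coef0 -[RHS](hermite_coefS_cst m 1).
  by congr gaussE; apply/funext => x; rewrite mul1r.
- by under eq_fun do rewrite hornerC; exact: hermite_coefS_cst.
- rewrite (@hermite_coefS _ _ n (is_derive_poly _)); try exact: gaussL2_horner.
    rewrite (_ : horner _ = (fun x => m.+1%:R * (hermite m).[x])); last first.
      by apply/funext => x; rewrite deriv_hermiteS hornerMn mulr_natl.
    rewrite hermite_coefZ ?IHn; last exact: gaussL2_horner.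
    rewrite eqSS; case: eqP => [->|_]; last by rewrite !mulr0n mulr0.
    by rewrite !mulr1n -natrM.
  exact: continuous_horner.
Qed.

End Hermite.

(** * A primitive: solving [F = x U - U'] *)

Section Primitive.
Context {R : realType}.
Implicit Types (x : R) (f g : R -> R).
Local Notation mu := (@lebesgue_measure R).
Local Notation w := (normal_pdf (0 : R) 1).

Lemma gaussL2_L1 f : gaussL2 f -> gaussL1 f.
Proof.
move=> hf; have := gaussL2M hf (gaussL2_cst 1).
by congr (gaussL1 _); apply/funext => x; rewrite mulr1.
Qed.

Lemma gaussE_indic (A : set R) f :
  gaussE (fun x => f x * \1_A x) = \int[mu]_(x in A) (f x * w x).
Proof.
rewrite Rintegral_mkcond /gaussE; congr Rintegral; apply/funext => x.
by rewrite patch_indic /= mulrAC.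
Qed.

Lemma gaussL2_indic (A : set R) : measurable A -> gaussL2 (\1_A : R -> R).
Proof.
move=> mA; split; first exact: measurable_indic.
apply: (le_gaussL1 _ _ (gaussL2_cst 1).2).
  by apply: measurable_funX; exact: measurable_indic.
move=> x; rewrite expr1n normrX indicE.
by case: (_ \in _); rewrite ?normr1 ?normr0 ?expr1n ?expr0n.
Qed.

(** Mills' bound: on the tail [a w <= x w = (- w)'], and [w] vanishes at infinity. *)
Lemma stdn_pdf_tail (a : R) : 0 < a ->
  a * \int[mu]_(x in `[a, +oo[) w x <= w a.
Proof.
move=> a0.
have L1 f : gaussL1 f -> mu.-integrable `[a, +oo[ (EFin \o (fun x => f x * w x)).
  by apply: integrableS.
have i1 : mu.-integrable `[a, +oo[ (EFin \o w).
  by apply: integrableS (integrable_normal_pdf 0 1).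
rewrite -RintegralZl//.
apply: (@le_trans _ _ (\int[mu]_(x in `[a, +oo[) (x * w x))).
  apply: le_Rintegral => //.
  - exact/L1/gaussL2_L1/gaussL2_cst.
  - exact/L1/gaussL2_L1/(gaussL2_exp 1).
  - by move=> x; rewrite /= in_itv/= andbT => ax; rewrite ler_wpM2r// normal_pdf_ge0.
have dw x : is_derive x 1 (fun x => - w x) (x * w x).
  have ? := is_derive_stdn_pdf x.
  by apply: is_derive_eq; rewrite mulNr opprK.
have cw : continuous (fun x => x * w x).
  by move=> x; apply: cvgM; [exact: cvg_id|exact: continuous_stdn_pdf].
rewrite (@Rintegral_ge0_continuous_FTC2y _ _ (fun x => - w x) a 0) ?sub0r ?opprK//.
- by move=> x ax; rewrite mulr_ge0 ?normal_pdf_ge0// (le_trans (ltW a0)).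
- exact: continuous_subspaceT.
- by rewrite -[X in _ --> X]oppr0; apply: cvgN; exact: stdn_pdf_cvg0.
- by apply/cvg_at_right_filter; exact: (is_derive_continuous dw).
- by move=> x _; rewrite derive1E derive_val.
Qed.

Lemma stdn_pdf_tailN (a : R) : 0 < a ->
  a * \int[mu]_(x in `]-oo, - a]) w x <= w a.
Proof.
move=> a0; rewrite /Rintegral ge0_integration_by_substitutionNy.
- by under eq_integral do rewrite /= stdn_pdfN; exact: stdn_pdf_tail.
- by apply: continuous_subspaceT; exact: continuous_stdn_pdf.
- by move=> x _; exact: normal_pdf_ge0.
Qed.

(** Monotone convergence along an exhaustion of the line; it makes the primitive below square
    integrable, which is not known beforehand. *)
Lemma ge0_integrable_itvNnn (h : R -> R) (M : R) :
  (forall x, 0 <= h x) -> continuous h ->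
  (forall n, \int[mu]_(x in `[- n.+1%:R, n.+1%:R]) h x <= M) ->
  mu.-integrable setT (EFin \o h).
Proof.
move=> h0 ch hM.
pose I n := `[- n.+1%:R, n.+1%:R : R].
have ih n : mu.-integrable (I n) (EFin \o h).
  by apply: continuous_compact_integrable;
    [exact: segment_compact|exact: continuous_subspaceT].
apply/integrableP; split; first by apply/measurable_EFinP; exact: continuous_measurable_fun.
under eq_integral do rewrite gee0_abs ?lee_fin ?h0//.
apply: (@le_lt_trans _ _ M%:E); last exact: ltry.
have IT : \bigcup_n I n = setT.
  rewrite -subTset => x _; exists (Num.truncn `|x|) => //=.
  by rewrite /I /= in_itv /= -ler_norml ltW// truncnS_gt.
have mI n : measurable (I n) by exact: measurable_itv.
have ndI : nondecreasing_seq I.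
  apply/nondecreasing_seqP => n; rewrite subsetEset => x; rewrite /I /= !in_itv /= -!ler_norml.
  by move=> /le_trans; apply; rewrite ler_nat.
have := @ge0_nondecreasing_set_cvg_integral _ (measurableTypeR R) R I (EFin \o h)
  mu ndI mI (fun n => measurable_int _ (ih n)) (fun n x _ => h0 x).
rewrite IT => cvgI; rewrite -(cvg_lim _ cvgI)//.
apply: lime_le; first by apply/cvg_ex; eexists; exact: cvgI.
apply: nearW => n.
rewrite -(fineK (integrable_fin_num _ (ih n))); last exact: measurable_itv.
by rewrite lee_fin; exact: hM.
Qed.

Variable F : R -> R.
Hypothesis (cF : continuous F) (F2 : gaussL2 F) (F0 : gaussE F = 0).

(** The equation [F = x U - U'] reads [(U w)' = - F w]; the solution with [U w] vanishing at [-oo]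
    is [U = - V / w]. *)
Let V x := \int[mu]_(t in `]-oo, x]) (F t * w t).

Let F1 : gaussL1 F.
Proof. exact: gaussL2_L1. Qed.

Let is_derive_V x : is_derive x 1 V (F x * w x).
Proof.
have [] := @continuous_FTC1 R (fun t => F t * w t) -oo%O x (x + 1) _ _ _ _.
- by rewrite ltrDl.
- by apply: integrableS F1.
- by rewrite ltNyr.
- by apply: cvgM; [exact: cF|exact: continuous_stdn_pdf].
by move=> dV; rewrite derive1E => <-; exact/derivableP.
Qed.

(* Cauchy-Schwarz on a tail, on the side of [x] since [E F = 0] makes [V x] also
   the opposite of the integral over [`]x, +oo[], and Mills' bound on its mass. *)
Let V_bound x : `|x| * V x ^+ 2 <= gaussE (fun t => F t ^+ 2) * w x.
Proof.
have [->|x0] := eqVneq x 0.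
  by rewrite normr0 mul0r mulr_ge0 ?normal_pdf_ge0//; apply: gaussE_ge0 => t; exact: sqr_ge0.
suff [A [mA hA hw]] : exists A : set R, [/\ measurable A,
    V x ^+ 2 = gaussE (fun t => F t * \1_A t) ^+ 2 &
    `|x| * \int[mu]_(t in A) w t <= w x].
  rewrite hA; apply: (@le_trans _ _
    (`|x| * (gaussE (fun t => F t ^+ 2) * gaussE (fun t => \1_A t ^+ 2)))).
    by rewrite ler_wpM2l//; apply: gaussE_cauchy_schwarz => //; exact: gaussL2_indic.
  rewrite mulrCA ler_wpM2l//; first by apply: gaussE_ge0 => t; exact: sqr_ge0.
  have -> : (fun t => \1_A t ^+ 2) = (fun t => 1 * \1_A t) :> (R -> R).
    by apply/funext => t; rewrite mul1r indicE; case: (_ \in _); rewrite ?expr1n ?expr0n.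
  by rewrite gaussE_indic; under eq_Rintegral do rewrite mul1r.
have [xlt0|xgt0|] := ltgtP x 0; last by move/eqP: x0.
  exists `]-oo, x]; split => //; first by rewrite gaussE_indic.
  have := @stdn_pdf_tailN (- x); rewrite opprK stdn_pdfN oppr_gt0 ltr0_norm//; exact.
exists `]x, +oo[; split => //.
  suff -> : V x = - gaussE (fun t => F t * \1_(`]x, +oo[) t) by rewrite sqrrN.
  apply/eqP; rewrite -addr_eq0 gaussE_indic /V.
  have <- := @Rintegral_itvB R (fun t => F t * w t) -oo%O +oo%O x _ _ _ => //.
    by rewrite set_itvNyy -/(gaussE F) F0 sub0r subrr.
  by rewrite set_itvNyy.
rewrite Rintegral_itv_obnd_cbnd; first by rewrite gtr0_norm//; exact: stdn_pdf_tail.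
by apply: integrableS (integrable_normal_pdf 0 1).
Qed.

Let U x := - (V x / w x).

Let is_derive_U x : is_derive x 1 U (x * U x - F x).
Proof.
have w0 : w x != 0 by rewrite gt_eqF ?stdn_pdf_gt0.
have ? := is_derive_V x; have ? := is_derive_stdn_pdf x.
have ? := is_deriveV (f := w) w0.
rewrite /U; apply: is_derive_eq; rewrite /GRing.scale /=; field.
by [].
Qed.

(* [U = - V / w] satisfies [(U^2 + U'^2) w = F^2 w + (x U^2 w)'], and [V_bound]
   controls the boundary terms on [[-n, n]]. *)
Lemma gauss_primitive : exists U : R -> R,
  [/\ (forall x, is_derive x 1 U (x * U x - F x)),
      gaussL2 U & gaussL2 (fun x => x * U x - F x)].
Proof.
have cU : continuous U := is_derive_continuous is_derive_U.
have cU' : continuous (fun x => x * U x - F x).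
  by move=> x; apply: cvgB; [apply: cvgM; [exact: cvg_id|exact: cU]|exact: cF].
pose h x := (U x ^+ 2 + (x * U x - F x) ^+ 2) * w x.
pose E := gaussE (fun x => F x ^+ 2).
have h0 x : 0 <= h x by rewrite mulr_ge0 ?addr_ge0 ?sqr_ge0 ?normal_pdf_ge0.
have ch : continuous h.
  move=> x; apply: cvgM; last exact: continuous_stdn_pdf.
  by apply: cvgD; under eq_fun do rewrite expr2; apply: cvgM;
    [exact: cU..|exact: cU'|exact: cU'].
have cFw : continuous (fun x => F x ^+ 2 * w x).
  move=> x; apply: cvgM; last exact: continuous_stdn_pdf.
  by under eq_fun do rewrite expr2; apply: cvgM; exact: cF.
pose K x := x * U x ^+ 2 * w x.
have dK x : is_derive x 1 K (h x - F x ^+ 2 * w x).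
  have ? := is_derive_U x; have ? := is_derive_stdn_pdf x.
  by rewrite /K; apply: is_derive_eq; rewrite /GRing.scale /= /h; ring.
have K_bound x : `|K x| <= E.
  have -> : K x = x * V x ^+ 2 / w x by rewrite /K /U; field; rewrite gt_eqF ?stdn_pdf_gt0.
  rewrite normf_div (gtr0_norm (stdn_pdf_gt0 x)) ler_pdivrMr ?stdn_pdf_gt0//.
  by rewrite normrM (ger0_norm (sqr_ge0 (V x))) V_bound.
have ih : mu.-integrable setT (EFin \o h).
  (* One [E] bounds the integral of [F^2 w], the other two bound [K] at the endpoints. *)
  apply: (@ge0_integrable_itvNnn _ (3 * E)) => // n.
  set I := `[_, _].
  have iI f : continuous f -> mu.-integrable I (EFin \o f).
    by move=> cf; apply: continuous_compact_integrable;
      [exact: segment_compact|exact: continuous_subspaceT].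
  have -> : \int[mu]_(x in I) h x =
      \int[mu]_(x in I) (h x - F x ^+ 2 * w x) + \int[mu]_(x in I) (F x ^+ 2 * w x).
    rewrite -RintegralD; [|exact: measurable_itv| |exact: iI].
      by apply: eq_Rintegral => x _; rewrite subrK.
    by apply: iI => x; apply: cvgB; [exact: ch|exact: cFw].
  rewrite (Rintegral_derive _ dK); last 2 first.
  - by rewrite gtrN.
  - by move=> x; apply: cvgB; [exact: ch|exact: cFw].
  have : \int[mu]_(x in I) (F x ^+ 2 * w x) <= E.
    rewrite Rintegral_mkcond; apply: le_Rintegral => //.
    - have := iI _ cFw => /integrable_mkcond; rewrite -restrict_EFin; apply.
      exact: measurable_itv.
    - exact: F2.2.
    - move=> x _; rewrite patchE; case: ifP => // _.
      by rewrite mulr_ge0 ?sqr_ge0 ?normal_pdf_ge0.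
  have := K_bound n.+1%:R; have := K_bound (- n.+1%:R).
  by rewrite !ler_norml => /andP[? ?] /andP[? ?] ?; lra.
have mU : measurable_fun setT U by exact: continuous_measurable_fun.
have mU' : measurable_fun setT (fun x => x * U x - F x) by exact: continuous_measurable_fun.
exists U; split => //; split => //.
- apply: (@le_gaussL1 _ _ (fun x => U x ^+ 2 + (x * U x - F x) ^+ 2)) => //.
    exact: measurable_funX.
  by move=> x; rewrite ger0_norm ?sqr_ge0// lerDl sqr_ge0.
- apply: (@le_gaussL1 _ _ (fun x => U x ^+ 2 + (x * U x - F x) ^+ 2)) => //.
    exact: measurable_funX.
  by move=> x; rewrite ger0_norm ?sqr_ge0// lerDr sqr_ge0.
Qed.

End Primitive.

(** * Spectral gap and Parseval identity *)

Section SpectralGap.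
Context {R : realType}.
Implicit Types (x : R) (f g : R -> R).

(* If [F = x U - U'], then [E F^2 = E (F' U) = E U^2 + E U'^2] by parts, and [U]
   is orthogonal to one Hermite polynomial less, which drives the induction. *)
Lemma gauss_spectral_gap n (F F' : R -> R) :
  (forall x, is_derive x 1 F (F' x)) -> continuous F' ->
  gaussL2 F -> gaussL2 F' ->
  (forall j, (j < n)%N -> hermite_coef j F = 0) ->
  n%:R * gaussE (fun x => F x ^+ 2) <= gaussE (fun x => F' x ^+ 2).
Proof.
elim: n F F' => [|n IHn] F F' dF cF' F2 F'2 F0.
  by rewrite mul0r; apply: gaussE_ge0 => x; exact: sqr_ge0.
have cF := is_derive_continuous dF.
have [U [dU U2 U'2]] := gauss_primitive cF F2 (etrans (esym (hermite_coef0 F)) (F0 0 isT)).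
have cU := is_derive_continuous dU.
pose U' x := x * U x - F x; pose U'' x := U x + x * U' x - F' x.
have cU' : continuous U'.
  by move=> x; apply: cvgB; [apply: cvgM; [exact: cvg_id|exact: cU]|exact: cF].
have dU' x : is_derive x 1 U' (U'' x).
  rewrite /U'; have ? := dU x; have ? := dF x.
  by apply: is_derive_eq; rewrite /GRing.scale /= /U'' /U'; ring.
have cU'' : continuous U''.
  move=> x; apply: cvgB; last exact: cF'.
  by apply: cvgD; [exact: cU|apply: cvgM; [exact: cvg_id|exact: cU']].
have deltaU : (fun x => x * U x - U' x) = F by apply/funext => x; rewrite /U' subKr.
have deltaU' : (fun x => x * U' x - U'' x) = (fun x => F' x - U x).
  by apply/funext => x; rewrite /U''; ring.
have FU : gaussE (fun x => F x ^+ 2) = gaussE (fun x => F' x * U x).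
  rewrite (gaussE_by_parts dF cF' dU cU') ?deltaU//.
  by congr gaussE; apply/funext => x; rewrite /U' subKr.
(* Integration by parts of [U' * U'] gives [E U'^2 = E (U (F' - U))]. *)
have UU : gaussE (fun x => F' x * U x) =
    gaussE (fun x => U x ^+ 2) + gaussE (fun x => U' x ^+ 2).
  have := gaussE_by_parts dU cU' dU' cU'' U2 U'2 U'2.
  rewrite deltaU' => /(_ (gaussL2B F'2 U2)) UU'.
  have -> : gaussE (fun x => U' x ^+ 2) = gaussE (fun x => U x * (F' x - U x)).
    rewrite -[RHS](_ : gaussE (fun x => U x * (x * U' x - U'' x)) = _).
      by rewrite -UU'.
    by congr gaussE; apply/funext => x; rewrite /U''; ring.
  rewrite -gaussED; [|exact: U2.2|exact/gaussL2M/gaussL2B].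
  by congr gaussE; apply/funext => x; ring.
(* [(j + 1) c_j U = E (H_(j+1)' U) = E (H_(j+1) F) = 0], where [H_j] is [hermite j]. *)
have U0 j : (j < n)%N -> hermite_coef j U = 0.
  move=> jn; have := F0 j.+1 jn.
  have := gaussE_by_parts (is_derive_poly (hermite j.+1))
    (@continuous_horner R _) dU cU' (gaussL2_horner _) (gaussL2_horner _) U2.
  rewrite deltaU => /(_ F2) HUF HF.
  have : j.+1%:R * hermite_coef j U = 0.
    rewrite -HF -(@hermite_coefZ _ j j.+1%:R U U2) /hermite_coef.
    transitivity (gaussE (fun x => (hermite j.+1).[x] * (x * U x - (x * U x - F x)))).
      rewrite -HUF; congr gaussE; apply/funext => x.
      by rewrite deriv_hermiteS hornerMn -mulr_natl; ring.
    by congr gaussE; apply/funext => x; rewrite subKr mulrC.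
  by move/eqP; rewrite mulf_eq0 pnatr_eq0 => /eqP.
have := IHn U U' dU cU' U2 U'2 U0.
(* The factor comes from the extremal case [F = hermite n.+1], where [U = hermite n] and
   [F' = n.+1 U]. Adding [n.+1] times the induction hypothesis to the expanded square gives the
   claim. *)
have : 0 <= gaussE (fun x => (F' x - n.+1%:R * U x) ^+ 2).
  by apply: gaussE_ge0 => x; exact: sqr_ge0.
rewrite gaussE_sqrB// FU UU -[n.+1%:R]natr1.
move: (gaussE (fun x => F' x ^+ 2)) (gaussE (fun x => U x ^+ 2)) (gaussE (fun x => U' x ^+ 2)).
move: (n%:R) (ler0n R n) => N N0 a b c abc bc.
have ncb : 0 <= (N + 1) * (c - N * b) by apply: mulr_ge0; [rewrite addr_ge0|rewrite subr_ge0].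
rewrite -subr_ge0 [X in 0 <= X](_ : _ = (a - 2 * (N + 1) * (b + c) + (N + 1) ^+ 2 * b) +
  (N + 1) * (c - N * b)); last by ring.
exact: addr_ge0.
Qed.

Definition hermite_proj N f : {poly R} :=
  \sum_(i < N) (hermite_coef i f / i`!%:R) *: hermite i.

Lemma horner_hermite_proj N f x : (hermite_proj N f).[x] =
  \sum_(i < N) hermite_coef i f / i`!%:R * (hermite i).[x].
Proof.
by rewrite /hermite_proj horner_sum; apply: eq_bigr => i _; rewrite hornerZ.
Qed.

Lemma hermite_coef_proj N f n :
  hermite_coef n (fun x => (hermite_proj N f).[x]) =
  if (n < N)%N then hermite_coef n f else 0.
Proof.
under eq_fun do rewrite horner_hermite_proj.
rewrite (@hermite_coef_sum _ n N
  (fun i x => hermite_coef i f / i`!%:R * (hermite i).[x])); last first.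
  by move=> i; exact/gaussL2Z/gaussL2_horner.
under eq_bigr => i _.
  rewrite hermite_coefZ; last exact: gaussL2_horner.
  rewrite hermite_coef_hermite; over.
case: ifPn => [nN|]; last first.
  rewrite -leqNgt => Nn; apply: big1 => i _.
  by rewrite gtn_eqF ?mulr0// (leq_trans (ltn_ord i)).
rewrite (bigD1 (Ordinal nN))//= eqxx mulr1n divfK ?pnatr_eq0 -?lt0n ?fact_gt0//.
rewrite big1 ?addr0// => i iN; rewrite (_ : n == i = false) ?mulr0//.
by apply/negbTE; move: iN; apply: contra => /eqP iN; apply/eqP/val_inj.
Qed.

Lemma gaussE_hermite_proj N f g : gaussL2 g ->
  gaussE (fun x => g x * (hermite_proj N f).[x]) =
  \sum_(i < N) hermite_coef i f * hermite_coef i g / i`!%:R.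
Proof.
move=> g2; under eq_fun do rewrite horner_hermite_proj.
elim: N => [|N IHN].
  under eq_fun do rewrite big_ord0 mulr0; rewrite big_ord0; exact: gaussE_cst.
under eq_fun do rewrite big_ord_recr/= mulrDr.
rewrite gaussED; last 2 first.
- apply: gaussL2M => //.
  apply: (@gaussL2_sum _ N (fun i x => hermite_coef i f / i`!%:R * (hermite i).[x])) => i.
  exact/gaussL2Z/gaussL2_horner.
- exact/gaussL2M/gaussL2Z/gaussL2_horner.
rewrite IHN big_ord_recr/=; congr (_ + _).
under eq_fun do rewrite mulrCA.
rewrite gaussEZ; last exact/gaussL2M/gaussL2_horner.
by rewrite -/(hermite_coef N g) [RHS]mulrAC.
Qed.

(** Pythagoras: [f] and its projection have the same scalar product with the projection. *)
Lemma gaussE_sqr_residual N f : gaussL2 f ->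
  gaussE (fun x => (f x - (hermite_proj N f).[x]) ^+ 2) =
  gaussE (fun x => f x ^+ 2) - \sum_(i < N) hermite_coef i f ^+ 2 / i`!%:R.
Proof.
move=> f2; have p2 := gaussL2_horner (hermite_proj N f).
have := gaussE_sqrB 1 f2 p2; under eq_fun do rewrite mul1r.
move=> ->; under [in X in _ + X]eq_fun do rewrite expr2.
rewrite !gaussE_hermite_proj// mulr1 expr1n mul1r.
under [in X in _ + X]eq_bigr => i _ do rewrite hermite_coef_proj ltn_ord -expr2.
under [in X in _ - X + _]eq_bigr => i _ do rewrite -expr2.
ring.
Qed.

Lemma gauss_bessel N f : gaussL2 f ->
  \sum_(i < N) hermite_coef i f ^+ 2 / i`!%:R <= gaussE (fun x => f x ^+ 2).
Proof.
move=> f2; rewrite -subr_ge0 -gaussE_sqr_residual//.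
by apply: gaussE_ge0 => x; exact: sqr_ge0.
Qed.

(** Makes the residual of [f'] the derivative of the residual of [f], as the spectral gap
    requires. *)
Lemma deriv_hermite_proj N f f' :
  (forall i, hermite_coef i.+1 f = hermite_coef i f') ->
  deriv (hermite_proj N.+1 f) = hermite_proj N f'.
Proof.
move=> ff'; rewrite /hermite_proj big_ord_recl derivD derivZ derivC scaler0 add0r.
rewrite raddf_sum /=; apply: eq_bigr => i _; rewrite derivZ deriv_hermiteS.
rewrite ff' -[hermite i *+ _]scaler_nat scalerA factS natrM; congr (_ *: _).
by field; rewrite pnatr_eq0 -lt0n fact_gt0 nat1r pnatr_eq0.
Qed.

(** The spectral gap is applied to [f] minus its projection, which is orthogonal to the first [N]
    Hermite polynomials; its derivative is a residual of [f'], of norm at most that of [f']. *)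
Lemma gauss_parseval_rate N f f' :
  (forall x, is_derive x 1 f (f' x)) -> continuous f' ->
  gaussL2 f -> gaussL2 f' ->
  N%:R * (gaussE (fun x => f x ^+ 2) - \sum_(i < N) hermite_coef i f ^+ 2 / i`!%:R)
  <= gaussE (fun x => f' x ^+ 2).
Proof.
case: N => [|N] df cf' f2 f'2.
  by rewrite mul0r; apply: gaussE_ge0 => x; exact: sqr_ge0.
have ff' i : hermite_coef i.+1 f = hermite_coef i f' by exact: hermite_coefS.
rewrite -gaussE_sqr_residual//.
have p2 := @gaussL2_horner R.
apply: (le_trans (@gauss_spectral_gap N.+1 (fun x => f x - (hermite_proj N.+1 f).[x])
  (fun x => f' x - (hermite_proj N f').[x]) _ _ _ _ _)).
- move=> x; rewrite -(deriv_hermite_proj N ff').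
  by apply: is_deriveB; exact: is_derive_poly.
- by move=> x; apply: cvgB; [exact: cf'|exact: continuous_horner].
- exact: gaussL2B.
- exact: gaussL2B.
- move=> j jN; have -> : (fun x => f x - (hermite_proj N.+1 f).[x]) =
      (fun x => f x + (-1) * (hermite_proj N.+1 f).[x]).
    by apply/funext => x; rewrite mulN1r.
  rewrite hermite_coefD ?hermite_coefZ ?hermite_coef_proj ?jN ?mulN1r ?subrr//.
  exact: gaussL2Z.
- rewrite gaussE_sqr_residual// lerBlDr lerDl sumr_ge0// => i _.
  by rewrite divr_ge0 ?sqr_ge0.
Qed.

End SpectralGap.

(** * Binomial sums *)

Section BinomialSums.
Context {R : realType}.

(** Pascal's rule telescopes the sum. *)
Lemma alternating_sum_bin n k :
  \sum_(0 <= j < k.+1) (-1) ^+ j * 'C(n.+1, j)%:R = (-1) ^+ k * 'C(n, k)%:R :> R.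
Proof.
elim: k => [|k IHk]; first by rewrite big_nat1 !bin0.
by rewrite big_nat_recr//= IHk binS natrD exprS; ring.
Qed.

(** [e j] stands for [E (G^(j)(Z)^2)] and [b n] for [(c_n G)^2]. The hypothesis [rate] stops at [m]
    because it involves one more derivative. *)
Variables (m : nat) (e b : nat -> R).
Hypothesis b_ge0 : forall n, 0 <= b n.
Hypothesis bessel : forall j N, (j <= m.+1)%N ->
  \sum_(i < N) b (i + j) / i`!%:R <= e j.
Hypothesis rate : forall j N, (j <= m)%N ->
  N%:R * (e j - \sum_(i < N) b (i + j) / i`!%:R) <= e j.+1.

Let a n : R := b n / n`!%:R.
Let s j N : R := \sum_(n < N) 'C(n, j)%:R * a n.

Let a_ge0 n : 0 <= a n. Proof. by rewrite /a divr_ge0. Qed.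

Let factP n : n`!%:R != 0 :> R. Proof. by rewrite pnatr_eq0 -lt0n fact_gt0. Qed.

(** With [n = i + j], [1 / i! = j! 'C(n, j) / n!]; the terms with [n < j] vanish. *)
Let sE j N : \sum_(i < N) b (i + j) / i`!%:R = j`!%:R * s j (N + j).
Proof.
rewrite /s; elim: N => [|N IHN].
  by rewrite big_ord0 big1 ?mulr0// => i _; rewrite bin_small ?mul0r.
rewrite big_ord_recr /= IHN addSn big_ord_recr /= mulrDr; congr (_ + _).
have := bin_fact (leq_addl N j); rewrite addnK /a => <-.
have := bin_gt0 (N + j) j; rewrite leq_addl => C0.
rewrite !natrM; field; rewrite !factP /=.
by rewrite pnatr_eq0 -lt0n C0.
Qed.

Let s_le j N : (j <= m.+1)%N -> s j N <= e j / j`!%:R.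
Proof.
move=> jm; rewrite ler_pdivlMr ?ltr0n ?fact_gt0//; apply: (le_trans _ (bessel N jm)).
rewrite sE mulrC ler_wpM2l// /s big_split_ord /= lerDl sumr_ge0// => i _.
by rewrite mulr_ge0.
Qed.

Let s_cvg j : (j <= m)%N -> s j N @[N --> \oo] --> e j / j`!%:R.
Proof.
(* The shift by [j] matches [sE]; the shift by one allows the division by [N.+1] in [rate]. *)
move=> jm; rewrite -(cvg_shiftn j) -cvg_shiftS.
apply: (@squeeze_cvgr _ _ _ _
  (fun N => (e j - e j.+1 * harmonic N) / j`!%:R) (cst (e j / j`!%:R))).
- apply: nearW => N; rewrite s_le ?(leqW jm)// andbT ler_pdivrMr ?ltr0n ?fact_gt0//.
  rewrite [leRHS]mulrC -sE lerBlDr -lerBlDl /harmonic ler_pdivlMr ?ltr0n// mulrC.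
  exact: rate.
- have <- : (e j - e j.+1 * 0) / j`!%:R = e j / j`!%:R by rewrite mulr0 subr0.
  by apply: cvgMl; apply: cvgB; [exact: cvg_cst|apply: cvgMr; exact: cvg_harmonic].
- exact: cvg_cst.
Qed.

(** Both bounds hold for truncated series and pass to the limit. The limit only concerns orders at
    most [k <= m], where [s_cvg] applies; order [k.+1], possibly [m.+1], enters through [s_le]
    alone. *)
Lemma alternating_energy_bounds k : (k <= m)%N ->
  a k.+1 <= (-1) ^+ k * (e 0%N - b 0%N +
    \sum_(1 <= j < k.+1) (-1) ^+ j * (e j / j`!%:R)) <= e k.+1 / k.+1`!%:R.
Proof.
move=> km.
pose T N := (-1) ^+ k * (s 0 N - b 0%N + \sum_(1 <= j < k.+1) (-1) ^+ j * s j N).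
(* The index 0 drops out: [b 0] cancels its term in [s 0], and ['C(0, j) = 0] for [j >= 1]. *)
have TE N : T N.+1 = \sum_(i < N) 'C(i, k)%:R * a i.+1.
  rewrite /T; have -> : s 0 N.+1 - b 0%N = \sum_(i < N) 'C(i.+1, 0)%:R * a i.+1.
    rewrite /s big_ord_recl bin0 mul1r /a fact0 divr1 addrC addKr.
    by apply: eq_bigr => i _; rewrite !bin0.
  rewrite [X in _ + X](_ : _ = \sum_(i < N)
    (\sum_(1 <= j < k.+1) (-1) ^+ j * 'C(i.+1, j)%:R) * a i.+1).
    rewrite -big_split /= mulr_sumr; apply: eq_bigr => i _.
    rewrite -mulrDl mulrA; congr (_ * _).
    have alt := alternating_sum_bin i k; rewrite big_ltn// expr0 mul1r in alt.
    rewrite alt.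
    by rewrite mulrA -expr2 sqrr_sign mul1r.
  under [RHS]eq_bigr do rewrite mulr_suml.
  rewrite exchange_big /=; apply: eq_big_nat => j /andP[j0 _].
  rewrite /s big_ord_recl bin_small// mul0r add0r mulr_sumr.
  by apply: eq_bigr => i _; rewrite mulrA.
have cT : T N @[N --> \oo] --> (-1) ^+ k * (e 0%N - b 0%N +
    \sum_(1 <= j < k.+1) (-1) ^+ j * (e j / j`!%:R)).
  apply: cvgMr; apply: cvgD.
    apply: cvgB; last exact: cvg_cst.
    by have := s_cvg (leq0n m); rewrite fact0 divr1.
  (* Recording the range as a predicate gives [cvg_big] access to [j <= k]. *)
  rewrite big_nat [X in X N @[N --> _]](_ : _ = (fun N =>
    \sum_(1 <= j < k.+1 | (1 <= j < k.+1)%N) (-1) ^+ j * s j N)); last first.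
    by apply/funext => N; rewrite -big_nat.
  apply: cvg_big; first exact: add_continuous.
  move=> j /andP[_ jk]; apply: cvgMr; apply: s_cvg.
  by move: jk; rewrite ltnS => /leq_trans; apply.
apply/andP; split.
- apply: (cvgr_to_ge cT); near=> N.
  have kN : (k.+1 < N)%N by near: N; exact: nbhs_infty_gt.
  have kN1 : (k < N.-1)%N by rewrite ltn_predRL.
  (* The single term [i = k], of coefficient 1, is [a k.+1]. *)
  rewrite -(ltn_predK kN) TE (bigD1 (Ordinal kN1))//= binn mul1r lerDl.
  by apply: sumr_ge0 => i _; rewrite mulr_ge0.
- apply: (cvgr_to_le cT); near=> N.
  have N0 : (0 < N)%N by near: N; exact: nbhs_infty_gt.
  rewrite -(ltn_predK N0) TE; apply: le_trans (s_le N.-1.+1 (km : k.+1 <= m.+1)%N).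
  rewrite /s big_ord_recl bin_small// mul0r add0r; apply: ler_sum => i _.
  (* By Pascal's rule, ['C(i, k) <= 'C(i.+1, k.+1)]. *)
  by rewrite ler_wpM2r// ler_nat binS leq_addl.
Unshelve. all: by end_near. Qed.

(** For large [N] the truncation is the sum of [a n] over [k < n < N]: its first term is the lower
    bound, and ['C(n, k.+1) >= 1] gives the upper one. *)
Lemma hermite_tail_bounds k : (k <= m)%N ->
  a k.+1 <= e 0%N - b 0%N - \sum_(1 <= j < k.+1) b j / j`!%:R <= e k.+1 / k.+1`!%:R.
Proof.
move=> km.
have b0 : b 0%N = a 0%N by rewrite /a fact0 divr1.
have sN N : (k < N)%N -> s 0 N - b 0%N - \sum_(1 <= j < k.+1) b j / j`!%:R =
    \sum_(k.+1 <= n < N) a n.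
  move=> kN; rewrite b0 -addrA -opprD -big_ltn//.
  rewrite /s -(big_mkord xpredT (fun n => 'C(n, 0)%:R * a n)).
  rewrite (@big_cat_nat _ _ _ k.+1)//=; under eq_bigr do rewrite bin0 mul1r.
  by under [X in _ + X - _]eq_bigr do rewrite bin0 mul1r; rewrite addrC addKr.
have cT : s 0 N - b 0%N - \sum_(1 <= j < k.+1) b j / j`!%:R @[N --> \oo] -->
    e 0%N - b 0%N - \sum_(1 <= j < k.+1) b j / j`!%:R.
  apply: cvgB; last exact: cvg_cst.
  apply: cvgB; last exact: cvg_cst.
  by have := s_cvg (leq0n m); rewrite fact0 divr1.
apply/andP; split.
- apply: (cvgr_to_ge cT); near=> N.
  have kN : (k.+1 < N)%N by near: N; exact: nbhs_infty_gt.
  by rewrite sN ?(ltnW kN)// big_ltn// lerDl sumr_ge0.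
- apply: (cvgr_to_le cT); near=> N.
  have kN : (k.+1 < N)%N by near: N; exact: nbhs_infty_gt.
  rewrite sN ?(ltnW kN)//; apply: le_trans (s_le N (km : k.+1 <= m.+1)%N).
  rewrite /s -(big_mkord xpredT (fun n => 'C(n, k.+1)%:R * a n)).
  rewrite [leRHS](@big_cat_nat _ _ _ k.+1) ?(ltnW kN)//=.
  rewrite ler_wpDl//; first by apply: sumr_ge0 => i _; rewrite mulr_ge0.
  rewrite big_nat [leRHS]big_nat; apply: ler_sum => i /andP[ki _].
  by rewrite ler_peMl// ler1n bin_gt0.
Unshelve. all: by end_near. Qed.

End BinomialSums.

(** * From the random variable to the Gaussian weight *)

Section StandardNormal.
Context {R : realType}.
Local Notation mu := (@lebesgue_measure R).
Local Notation w := (normal_pdf (0 : R) 1).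
Local Notation gam := (@normal_prob R 0 1).

(** The Radon-Nikodym derivative of [gam] and [w] have the same integral over every measurable set,
    hence agree almost everywhere. *)
Lemma integral_stdn_prob (f : R -> R) : gam.-integrable setT (EFin \o f) ->
  (\int[gam]_x (f x)%:E = \int[mu]_x (f x * w x)%:E)%E.
Proof.
move=> if_; have dom := @normal_prob_dominates R 0 1.
have mw : measurable_fun setT (fun x => (w x)%:E).
  by apply/measurable_EFinP; exact: measurable_normal_pdf.
rewrite -(Radon_Nikodym_change_of_variables dom)//.
under [RHS]eq_integral do rewrite EFinM.
apply: ae_eq_integral => //.
- apply: emeasurable_funM; first exact: measurable_int if_.
  by apply: (measurable_int mu); apply: Radon_Nikodym_integrable.
- by apply: emeasurable_funM => //; exact: measurable_int if_.
apply: ae_eqe_mul2l; rewrite Radon_NikodymE.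
case: cid => h [h1 h2 h3] /=.
apply: integral_ae_eq => //.
by move=> A _ mA; rewrite -h3.
Qed.

Context d (T : measurableType d) (P : probability T R) (Z : {RV P >-> R}).
Hypothesis hZ : standard_normal Z.

(* [lebesgue_measure] and [normal_prob] live on [measurableTypeR R], whose display
   is not the one of [R], the codomain of [Z]. *)
Let ZR : T -> measurableTypeR R := Z.

Let mZR : measurable_fun setT ZR.
Proof. exact: (@measurable_funPT _ _ _ _ Z). Qed.

Lemma ge0_expectation_stdn (f : R -> \bar R) :
  measurable_fun (setT : set (measurableTypeR R)) f ->
  (forall x, 0 <= f x)%E -> (\int[gam]_x f x = \int[P]_t f (Z t))%E.
Proof.
move=> mf f0.
have := @ge0_integral_pushforward _ _ _ _ R ZR mZR P setT f measurableT mf (fun x _ => f0 x).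
rewrite preimage_setT => <-.
by apply: eq_measure_integral => A mA _; exact: (esym (hZ mA)).
Qed.

Lemma expectation_stdn (f : R -> R) : measurable_fun setT f ->
  P.-integrable setT (EFin \o (f \o Z)) ->
  gaussL1 f /\ 'E_P[f \o Z]%E = (gaussE f)%:E.
Proof.
move=> mf ifZ.
have mf' : measurable_fun setT (EFin \o f) by exact/measurable_EFinP.
have [_ fZoo] := integrableP _ _ _ ifZ.
(* Absolute values come first: they carry integrability from [P] to [gam], then to [f * w]. *)
have Zabs : (\int[gam]_x `|(f x)%:E| = \int[P]_t `|(f (Z t))%:E|)%E.
  by rewrite (@ge0_expectation_stdn (fun x => `|(f x)%:E|)%E)//; exact: measurableT_comp.
have if_ : gam.-integrable setT (EFin \o f) by apply/integrableP; split => //; rewrite Zabs.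
have iabs := integrable_norm if_.
have fw : gaussL1 f.
  apply/integrableP; split.
    by apply/measurable_EFinP; apply: measurable_funM => //; exact: measurable_normal_pdf.
  have <- : (\int[gam]_x `|(f x)%:E| = \int[mu]_x `|(f x * w x)%:E|)%E.
    rewrite (integral_stdn_prob iabs); apply: eq_integral => x _.
    by rewrite /= normrM (ger0_norm (normal_pdf_ge0 _ _ _)).
  by rewrite Zabs.
split => //; rewrite unlock /gaussE /Rintegral fineK ?integrable_fin_num//.
rewrite -integral_stdn_prob//.
have := @integral_pushforward _ _ _ _ R ZR mZR P setT (EFin \o f) mf' ifZ measurableT.
rewrite preimage_setT => <-.
by apply: eq_measure_integral => A mA _; exact: (hZ mA).
Qed.

Lemma expectation_sqr_stdn (f : R -> R) : measurable_fun setT f ->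
  ('E_P[(fun t => f (Z t) ^+ 2)%R] < +oo)%E ->
  [/\ gaussL2 f, 'E_P[(fun t => f (Z t) ^+ 2)%R]%E = (gaussE (fun x => f x ^+ 2))%:E,
   'E_P[f \o Z]%E = (gaussE f)%:E &
   'V_P[f \o Z]%E = (gaussE (fun x => f x ^+ 2) - gaussE f ^+ 2)%:E].
Proof.
move=> mf f2; have f2oo : (\int[P]_t (f (Z t) ^+ 2)%:E < +oo)%E by move: f2; rewrite unlock.
have mfZ : measurable_fun setT (f \o Z) by exact: measurableT_comp.
have i2 : P.-integrable setT (EFin \o ((fun x => f x ^+ 2) \o Z)).
  apply/integrableP; split.
    by apply/measurable_EFinP; exact: measurable_funX.
  by under eq_integral do rewrite /= ger0_norm ?sqr_ge0//.
(* Domination by [1 + f^2]. *)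
have i1 : P.-integrable setT (EFin \o (f \o Z)).
  have i11 : P.-integrable setT (EFin \o cst 1) by exact: finite_measure_integrable_cst.
  apply: (le_integrable measurableT _ _ (integrableD measurableT i11 i2)).
    exact/measurable_EFinP.
  move=> t _ /=; rewrite lee_fin [leRHS]ger0_norm ?addr_ge0 ?sqr_ge0//.
  rewrite -(real_normK (num_real (f (Z t)))).
  by move: `|_| (normr_ge0 (f (Z t))) => u u0; nra.
have [E2 EE2] := expectation_stdn (measurable_funX 2 mf) i2.
have [E1 EE1] := expectation_stdn mf i1.
split => //; rewrite /variance covarianceE; try exact/Lfun1_integrable.
  rewrite (_ : 'E_P[_ * _] = 'E_P[(fun t => f (Z t) ^+ 2)%R])%E; last first.
    by congr expectation; apply/funext => t; rewrite /= expr2.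
  by rewrite [X in (X - _)%E]EE2 EE1.
Qed.

End StandardNormal.

(** * Iterated derivatives and their Hermite coefficients *)

Section ContinuouslyDifferentiable.
Context {R : realType} (n : nat) (G : R -> R).
Hypothesis hG : continuously_differentiable n G.

Lemma is_derive_derive1n j (x : R) : (j < n)%N -> is_derive x 1 G^`(j) (G^`(j.+1) x).
Proof.
move=> jn; rewrite derive1nS derive1E; apply: derivableP.
by have [dG _] := hG; exact: dG.
Qed.

Lemma continuous_derive1n j : (j <= n)%N -> continuous G^`(j).
Proof.
rewrite leq_eqVlt => /predU1P[->|jn]; first by have [] := hG.
by apply: is_derive_continuous => x; exact: is_derive_derive1n.
Qed.

(** Lets the single sequence of coefficients of [G] serve all orders of derivation. *)
Lemma hermite_coef_derive1n j i : (forall j, (j <= n)%N -> gaussL2 G^`(j)) ->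
  (j <= n)%N -> hermite_coef i G^`(j) = hermite_coef (i + j) G.
Proof.
move=> G2; elim: j i => [|j IHj] i jn; first by rewrite addn0.
rewrite addnS -addSn -IHj ?(ltnW jn)//; apply/esym/hermite_coefS.
- by move=> x; exact: is_derive_derive1n.
- exact: continuous_derive1n.
- exact/G2/ltnW.
- exact: G2.
Qed.

End ContinuouslyDifferentiable.

Unset Implicit Arguments.

Local Open Scope ereal_scope.

Theorem proposition3p2 (R : realType) (d : measure_display)
    (T : measurableType d) (P : probability T R) (Z : {RV P >-> R})
    (m : nat) (G : R -> R)
    (hZ : standard_normal Z)
    (hm : (1 <= m)%N)
    (hG : continuously_differentiable m.+1 G)
    (hG2 : forall k : nat, (k <= m.+1)%N ->
       'E_P[(fun w => G^`(k)%classic (Z w) ^+ 2)%R] < +oo) :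
  forall k : nat, (1 <= k <= m)%N ->
    ('E_P[G^`(k.+1) \o Z] ^+ 2 / ((k.+1)`!%:R)%:E
       <= ((-1) ^+ k)%:E *
          ('V_P[G \o Z] +
           \sum_(1 <= j < k.+1)
             ((-1) ^+ j)%:E *
             ('E_P[(fun w => G^`(j)%classic (Z w) ^+ 2)%R] / (j`!%:R)%:E))
     /\
     ((-1) ^+ k)%:E *
          ('V_P[G \o Z] +
           \sum_(1 <= j < k.+1)
             ((-1) ^+ j)%:E *
             ('E_P[(fun w => G^`(j)%classic (Z w) ^+ 2)%R] / (j`!%:R)%:E))
       <= 'E_P[(fun w => G^`(k.+1)%classic (Z w) ^+ 2)%R] / ((k.+1)`!%:R)%:E)
    /\
    ('E_P[G^`(k.+1) \o Z] ^+ 2 / ((k.+1)`!%:R)%:E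
       <= 'V_P[G \o Z] -
          \sum_(1 <= j < k.+1) 'E_P[G^`(j) \o Z] ^+ 2 / (j`!%:R)%:E
     /\
     'V_P[G \o Z] -
          \sum_(1 <= j < k.+1) 'E_P[G^`(j) \o Z] ^+ 2 / (j`!%:R)%:E
       <= 'E_P[(fun w => G^`(k.+1)%classic (Z w) ^+ 2)%R] / ((k.+1)`!%:R)%:E).
Proof.
move=> k /andP[k1 km].
have GE j (jm : (j <= m.+1)%N) := expectation_sqr_stdn hZ
  (continuous_measurable_fun (continuous_derive1n hG jm)) (hG2 j jm).
have G2 j (jm : (j <= m.+1)%N) : gaussL2 G^`(j) by have [] := GE j jm.
pose e j : R := gaussE (fun x => (G^`(j)%classic x ^+ 2)%R).
pose b j : R := (hermite_coef j G ^+ 2)%R.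
have EG2 j (jm : (j <= m.+1)%N) :
    'E_P[(fun t => G^`(j)%classic (Z t) ^+ 2)%R] / (j`!%:R)%:E = (e j / j`!%:R)%:E.
  have [_ -> _ _] := GE j jm.
  by rewrite inver pnatr_eq0 eqn0Ngt fact_gt0.
have EG j (jm : (j <= m.+1)%N) :
    'E_P[G^`(j) \o Z] ^+ 2 / (j`!%:R)%:E = (b j / j`!%:R)%:E.
  have [_ _ -> _] := GE j jm.
  (* The mean of [G^(j)(Z)] is [c_0 (G^(j)) = c_j G]. *)
  rewrite -hermite_coef0 (hermite_coef_derive1n hG _ G2)// add0n.
  by rewrite inver pnatr_eq0 eqn0Ngt fact_gt0.
have V : 'V_P[G \o Z] = (e 0%N - b 0%N)%:E.
  by have [_ _ _ ->] := GE 0%N isT; rewrite /b hermite_coef0.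
have b0 j : (0 <= b j)%R by exact: sqr_ge0.
have bessel j N : (j <= m.+1)%N -> (\sum_(i < N) b (i + j)%N / i`!%:R <= e j)%R.
  move=> jm; have := gauss_bessel N (G2 j jm).
  by under eq_bigr do rewrite (hermite_coef_derive1n hG _ G2)//.
have rate j N : (j <= m)%N ->
    (N%:R * (e j - \sum_(i < N) b (i + j)%N / i`!%:R) <= e j.+1)%R.
  move=> jm; have := @gauss_parseval_rate _ N G^`(j) G^`(j.+1)
    (fun x => is_derive_derive1n hG x (jm : j < m.+1)%N)
    (continuous_derive1n hG (jm : j < m.+1)%N) (G2 _ (leqW jm)) (G2 _ (jm : j < m.+1)%N).
  by under eq_bigr do rewrite (hermite_coef_derive1n hG _ G2) ?(leqW jm)//.
have jk j : (1 <= j < k.+1)%N -> (j <= m.+1)%N.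
  by rewrite ltnS => /andP[_ /leq_trans]; apply; exact: leqW.
(* All terms being finite, the extended-real sums are sums of reals. *)
have -> : \sum_(1 <= j < k.+1) ((-1) ^+ j)%:E *
      ('E_P[(fun w => G^`(j)%classic (Z w) ^+ 2)%R] / (j`!%:R)%:E) =
    (\sum_(1 <= j < k.+1) (-1) ^+ j * (e j / j`!%:R))%:E.
  by rewrite -sumEFin; apply: eq_big_nat => j /jk jm; rewrite EG2.
have -> : \sum_(1 <= j < k.+1) 'E_P[G^`(j) \o Z] ^+ 2 / (j`!%:R)%:E =
    (\sum_(1 <= j < k.+1) b j / j`!%:R)%:E.
  by rewrite -sumEFin; apply: eq_big_nat => j /jk jm; rewrite EG.
rewrite EG// EG2// V -EFinB -EFinD -EFinM !lee_fin.
have /andP[? ?] := alternating_energy_bounds b0 bessel rate km.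
by have /andP[? ?] := hermite_tail_bounds b0 bessel rate km.
Qed.
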